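(* Let $S$ be a finite semigroup and let $M$ be a finite right $\mathbb BS$-module, where $\mathbb B$ is the boolean semiring. Then $M$ is simple if and only if the left $\mathbb BS$-module $M^{op}$ is minimal, and $M$ is minimal if and only if $M^{op}$ is simple.
   Context: $\mathbb B=\{0,1\}$ is the boolean semiring ($1+1=1$). A $\mathbb B$-module is a commutative idempotent additive monoid with zero (equivalently, a join semilattice with minimum $0$). A right (left) $\mathbb BS$-module is a $\mathbb B$-module with a right (left) action of $S$ by additive maps preserving $0$ (unitary if $\mathbb BS$ is unital). A congruence on a module is an equivalence relation compatible with addition and the action; it is proper if it has more than one class and trivial if all classes are singletons. A right $\mathbb BS$-module $M$ with $M\cdot\mathbb BS\neq0$ is simple if its only proper congruence is the trivial one, and minimal if its only submodules are $0$ and $M$; likewise for left modules. For a finite $\mathbb B$-module $M$, $M^{op}$ denotes the set of functionals $f\colon M\to\mathbb B$ (additive maps preserving $0$) with pointwise operations. (It is isomorphic to $M$ with the reverse ordering, via $m\mapsto\varphi_m$, where $\varphi_m(n)=0$ if $n\leq m$ and $1$ otherwise.) If $M$ is a right $\mathbb BS$-module, then $M^{op}$ is a left $\mathbb BS$-module by $(sf)(m)=f(ms)$. *)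

(* Defs.v *)
From HB Require Import structures.
From mathcomp Require Import all_boot all_order all_algebra.

Set Implicit Arguments.
Unset Strict Implicit.
Unset Printing Implicit Defensive.

Import GRing.Theory.

Local Open Scope ring_scope.

(* An alias of bool is needed: on bool itself MathComp has the structure of the
   field with two elements, where 1 + 1 = 0. *)
Definition BB : Type := bool.

HB.instance Definition _ := Finite.copy BB bool.
HB.instance Definition _ :=
  GRing.isNmodule.Build BB orbA orbC (orFb : left_id false orb).

Fact BB_1neq0 : (true : BB) != 0. Proof. by []. Qed.

HB.instance Definition _ := GRing.Nmodule_isComNzSemiRing.Build BB
  andbA andbC (andTb : left_id true andb) andb_orl andFb BB_1neq0.

Fact BB_add11 : 1 + 1 = 1 :> BB. Proof. by []. Qed.

HB.mixin Record Nmodule_isIdempotent M of GRing.Nmodule M := {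
  addrr : forall m : M, m + m = m
}.

#[short(type="finBModType")]
HB.structure Definition FinBModule :=
  {M of Nmodule_isIdempotent M & FinRing.Nmodule M}.

#[short(type="finSemigroupType")]
HB.structure Definition FinSemigroup := {S of Semigroup S & Finite S}.

Section SemigroupAlgebra.
Variable S : finSemigroupType.

(* The elements of BS, as coefficient functions of formal sums over S. *)
Definition BS : Type := {ffun S -> BB}.

Definition BS_mul (a b : BS) : BS :=
  [ffun s => \sum_(p : S * S | (p.1 * p.2)%g == s) a p.1 * b p.2].

Definition BS_unit (e : BS) : Prop :=
  forall a : BS, BS_mul e a = a /\ BS_mul a e = a.

(* The operator on M by which a in BS acts, given those of the elements of S.
   The side on which S acts is irrelevant here. *)
Definition BS_op (M : nmodType) (op : S -> M -> M) (a : BS) (m : M) : M :=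
  \sum_(s : S | a s == 1) op s m.

End SemigroupAlgebra.

HB.mixin Record isRightBSModule (S : finSemigroupType) M of GRing.Nmodule M := {
  ract : M -> S -> M;
  ract_nmod : forall s, nmod_morphism (ract^~ s);
  ractA : forall m s t, ract m (s * t)%g = ract (ract m s) t;
  ract_unitary : forall e : BS S, BS_unit e ->
    forall m, BS_op (fun s => ract^~ s) e m = m
}.

#[short(type="finRightBSModType")]
HB.structure Definition FinRightBSModule (S : finSemigroupType) :=
  {M of isRightBSModule S M & FinBModule M}.

HB.mixin Record isLeftBSModule (S : finSemigroupType) M of GRing.Nmodule M := {
  lact : S -> M -> M;
  lact_nmod : forall s, nmod_morphism (lact s);
  lactA : forall s t m, lact (s * t)%g m = lact s (lact t m);
  lact_unitary : forall e : BS S, BS_unit e -> forall m, BS_op lact e m = m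
}.

#[short(type="finLeftBSModType")]
HB.structure Definition FinLeftBSModule (S : finSemigroupType) :=
  {M of isLeftBSModule S M & FinBModule M}.

Section Operators.
Variables (S : finSemigroupType) (M : finBModType) (op : S -> M -> M).

Definition op_nonzero : Prop := exists m a, BS_op op a m != 0.

Definition op_submodule (N : {set M}) : Prop :=
  GRing.nmod_closed N /\ (forall s, {in N, forall m, op s m \in N}).

Definition op_congruence (r : rel M) : Prop :=
  [/\ equivalence_rel r,
      forall m m' n n', r m m' -> r n n' -> r (m + n) (m' + n')
    & forall s m m', r m m' -> r (op s m) (op s m')].

Definition proper_rel (r : rel M) : Prop := exists m n, ~~ r m n.

Definition trivial_rel (r : rel M) : Prop := forall m n, r m n -> m = n.

Definition op_simple : Prop :=
  op_nonzero /\
  (forall r, op_congruence r -> proper_rel r -> trivial_rel r).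

Definition op_minimal : Prop :=
  op_nonzero /\
  (forall N, op_submodule N -> N = [set 0] \/ N = [set: M]).

End Operators.

Definition right_simple (S : finSemigroupType) (M : finRightBSModType S) :=
  op_simple (fun (s : S) (m : M) => ract m s).

Definition right_minimal (S : finSemigroupType) (M : finRightBSModType S) :=
  op_minimal (fun (s : S) (m : M) => ract m s).

Definition left_simple (S : finSemigroupType) (M : finLeftBSModType S) :=
  op_simple (fun (s : S) (m : M) => lact s m).

Definition left_minimal (S : finSemigroupType) (M : finLeftBSModType S) :=
  op_minimal (fun (s : S) (m : M) => lact s m).

Section Functionals.
Variable M : finNmodType.

Definition functional : {pred {ffun M -> BB}} :=
  [pred f : {ffun M -> BB} |
    (f 0 == 0) && [forall m, forall n, f (m + n) == f m + f n]].

Lemma functionalP (f : {ffun M -> BB}) :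
  reflect (nmod_morphism f) (f \in functional).
Proof.
apply: (iffP andP) => [[/eqP f0 /forallP fD]|[f0 fD]]; split => //.
- by move=> m n; apply/eqP/(forallP (fD m)).
- exact/eqP.
- by apply/forallP => m; apply/forallP => n; rewrite fD.
Qed.

Fact functional_nmod_closed : GRing.nmod_closed functional.
Proof.
split=> [|f g /functionalP[f0 fD] /functionalP[g0 gD]]; apply/functionalP.
  by split=> [|m n]; rewrite !ffunE ?addr0.
by split=> [|m n]; rewrite !ffunE ?f0 ?g0 ?addr0 // fD gD addrACA.
Qed.

(* This is the module M^op; its addition is that of {ffun M -> BB}. *)
Record dual : Type :=
  Dual { dual_fun :> {ffun M -> BB}; _ : functional dual_fun }.

HB.instance Definition _ := [isSub for dual_fun].
HB.instance Definition _ := [Finite of dual by <:].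
HB.instance Definition _ :=
  GRing.SubChoice_isSubNmodule.Build {ffun M -> BB} functional dual
    functional_nmod_closed.

Fact dual_addrr (f : dual) : f + f = f.
Proof. by apply/val_inj/ffunP => m; rewrite raddfD ffunE; apply: orbb. Qed.

HB.instance Definition _ := Nmodule_isIdempotent.Build dual dual_addrr.

Lemma dual_nmod (f : dual) : nmod_morphism f.
Proof. exact/functionalP/(valP f). Qed.

Lemma dualP (f g : dual) : (forall m, f m = g m) <-> f = g.
Proof. by split=> [fg|->//]; apply/val_inj/ffunP. Qed.

Lemma dual_fun_nmod : nmod_morphism dual_fun.
Proof. by split; [apply: (raddf0 val) | apply: (raddfD val)]. Qed.

Lemma dual0E m : (0 : dual) m = 0.
Proof. by rewrite dual_fun_nmod.1 ffunE. Qed.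

Lemma dualDE (f g : dual) m : (f + g) m = f m + g m.
Proof. by rewrite dual_fun_nmod.2 ffunE. Qed.

End Functionals.

Section DualAction.
Variables (S : finSemigroupType) (M : finRightBSModType S).

Fact dual_lact_subproof (s : S) (f : dual M) :
  functional [ffun m : M => f (ract m s)].
Proof.
have [f0 fD] := dual_nmod f; have [s0 sD] := @ract_nmod S M s.
by apply/functionalP; split=> [|m n]; rewrite !ffunE ?s0 ?f0 // sD fD.
Qed.

Definition dual_lact (s : S) (f : dual M) : dual M :=
  Dual (dual_lact_subproof s f).

Lemma dual_lactE s f m : dual_lact s f m = f (ract m s).
Proof. exact: ffunE. Qed.

Fact dual_lact_nmod s : nmod_morphism (dual_lact s).
Proof.
by split=> [|f g]; apply/dualP => m; rewrite ?(dual0E, dualDE, dual_lactE).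
Qed.

Fact dual_lactA s t f : dual_lact (s * t)%g f = dual_lact s (dual_lact t f).
Proof. by apply/dualP => m; rewrite !dual_lactE ractA. Qed.

Fact dual_lact_unitary (e : BS S) : BS_unit e ->
  forall f, BS_op dual_lact e f = f.
Proof.
move=> e1 f; apply/dualP => m; have [f0 fD] := dual_nmod f.
rewrite -[in RHS](@ract_unitary S M e e1 m) /BS_op (big_morph _ fD f0).
rewrite (big_morph (fun g : dual M => g m) (id1 := 0) (op1 := +%R)).
- by apply: eq_bigr => s _; rewrite dual_lactE.
- by move=> g h; rewrite dualDE.
- exact: dual0E.
Qed.

HB.instance Definition _ := isLeftBSModule.Build S (dual M)
  dual_lact_nmod dual_lactA dual_lact_unitary.

End DualAction.

(* Main.v *)
Require Import Defs.
From mathcomp Require Import all_boot all_order all_algebra.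

(** Congruences on a module are dual to submodules of the other module of a
    pairing.  Let [p : A -> B -> BB] be additive in both arguments and separate
    the points of [A] and of [B], and let the actions of [S] on [A] and [B] be
    adjoint.  A submodule [N] of [B] gives the congruence on [A] that identifies
    the elements on which all of [N] agrees; a congruence on [A] gives the
    submodule of the [b] for which [p^~ b] is constant on its classes.  Two facts
    make this correspondence tight at its extremes.

    - A submonoid [N] of [B] that separates the points of [A] is all of [B]
      ([separating_set_represents]): a functional on a finite [A] is determined
      by the largest element [m] of its kernel, and the sum of the elements of
      [N] that vanish at [m] represents it.
    - Elements that are not congruent are separated by a functional that is
      constant on the congruence classes ([congruence_separated]), so a proper
      congruence gives a nonzero submodule.

    Hence [A] is simple if and only if [B] is minimal ([simple_iff_minimal]).
    Evaluation [M -> dual M -> BB] is such a pairing, and so is the same map with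
    its arguments exchanged; these give the two equivalences. *)

Set Implicit Arguments.
Unset Strict Implicit.
Unset Printing Implicit Defensive.

Import GRing.Theory.

Local Open Scope ring_scope.

Lemma sum_upper_bound (A : finBModType) (P : pred A) a :
  P a -> a + \sum_(x | P x) x = \sum_(x | P x) x.
Proof. by move=> Pa; rewrite (bigD1 a) //= addrA addrr. Qed.

Lemma functional_sum0 (A : finBModType) (P : pred A) (F : A -> BB) :
  nmod_morphism F -> (forall x, P x -> F x = 0) -> F (\sum_(x | P x) x) = 0.
Proof.
move=> [F0 FD] PF; apply: (big_ind (fun x => F x = 0)) => // x y Fx Fy.
by rewrite FD Fx Fy addr0.
Qed.

(** The functional is that of the quotient module which vanishes exactly below
    the class of [m]: it sends [a] to 0 when the class of [a + m] is that of [m].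
    If neither [m] nor [n] gave a functional separating the two, then [m + n]
    would be congruent to both. *)
Lemma congruence_separated (A : finBModType) (r : rel A) (m n : A) :
    equivalence_rel r ->
    (forall x x' y y', r x x' -> r y y' -> r (x + y) (x' + y')) ->
    ~~ r m n ->
  exists F : A -> BB,
    [/\ nmod_morphism F, forall a a', r a a' -> F a = F a' & F m != F n].
Proof.
move=> r_eqv rD.
have rxx x : r x x by case: (r_eqv x x x).
have rl x y z : r x y -> r x z = r y z by case: (r_eqv x y z) => _; apply.
have rs x y : r x y -> r y x by move=> xy; rewrite -(rl _ _ _ xy).
pose F c a : BB := ~~ r (a + c) c.
have F_nmod c : nmod_morphism (F c).
  split=> [|a b]; first by rewrite /F add0r rxx.
  (* addition in BB is disjunction, so the equation is a De Morgan law *)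
  rewrite /F -[RHS]negb_and; congr (~~ _).
  apply/idP/andP => [rab|[ra rb]]; last first.
    by rewrite -addrA (rl _ (a + c)) ?rD.
  (* c is congruent to a + b + c, so modulo r it absorbs what that sum absorbs *)
  have absorbed x : x + (a + b + c) = a + b + c -> r (x + c) c.
    move=> xE; rewrite (rl _ (x + (a + b + c))) ?xE //.
    by apply/rs; rewrite -{1}xE rD.
  split; apply: absorbed; first by rewrite !addrA addrr.
  by rewrite addrCA -!addrA [b + (b + c)]addrA addrr.
have F_compat c a a' : r a a' -> F c a = F c a'.
  by move=> raa'; rewrite /F (rl _ (a' + c)) ?rD.
have Fcc c : F c c = 0 by rewrite /F addrr rxx.
move=> nrmn; have [rnm|nrnm] := boolP (r (n + m) m).
  exists (F n); split; [exact: F_nmod | exact: F_compat |]; rewrite Fcc /F.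
  by apply: contraNneq nrmn => /negbFE; rewrite addrC (rl _ _ _ rnm).
exists (F m); split; [exact: F_nmod | exact: F_compat |].
by rewrite Fcc /F nrnm.
Qed.

Record nondegenerate_pairing (A B : finBModType) (p : A -> B -> BB) : Prop := {
  pairing_nmodl : forall b, nmod_morphism (p^~ b);
  pairing_nmodr : forall a, nmod_morphism (p a);
  pairing_sepl : forall a a', p a =1 p a' -> a = a';
  pairing_sepr : forall b b', p^~ b =1 p^~ b' -> b = b'
}.

Lemma nondegenerate_flip (A B : finBModType) (p : A -> B -> BB) :
  nondegenerate_pairing p -> nondegenerate_pairing (fun b a => p a b).
Proof. by case. Qed.

(** With [m] the largest element of the kernel of [F], the sum of the elements of
    [N] that vanish at [m] is the largest one to do so.  It is 0 at all [a] below
    [m].  For [a] not below [m], an element of [N] that separates [a + m] from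
    [m] must be 0 at [m] and 1 at [a], and it is one of the summands. *)
Lemma separating_set_represents (A B : finBModType) (p : A -> B -> BB)
    (N : {set B}) (F : A -> BB) :
    nondegenerate_pairing p -> GRing.nmod_closed N ->
    (forall a a', {in N, p a =1 p a'} -> a = a') -> nmod_morphism F ->
  exists2 b, b \in N & F =1 p^~ b.
Proof.
move=> pP [N0 ND] sepN F_nmod; have [F0 FD] := F_nmod.
pose m := \sum_(a | F a == 0) a.
have Fm : F m = 0 by apply: functional_sum0 => // a /eqP.
pose b := \sum_(c | (c \in N) && (p m c == 0)) c.
have pmb : p m b = 0.
  apply: functional_sum0; first exact: pairing_nmodr.
  by move=> c /andP[_ /eqP].
exists b => [|a].
  by apply: (big_ind (fun c => c \in N)) => // c /andP[].
have [Fa|Fa] := eqVneq (F a) 0.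
  have am : a + m = m by apply: sum_upper_bound; rewrite Fa.
  have := (pairing_nmodl pP b).2 a m; rewrite am pmb Fa /=.
  by case: (p a b).
have [c /andP[cN pc]] :
    exists c, (c \in N) && (p (a + m) c != p m c).
  apply/existsP; apply: contraNT Fa => /existsPn sameN.
  have am : a + m = m.
    by apply: sepN => c cN; have := sameN c; rewrite cN /= negbK => /eqP.
  by have := FD a m; rewrite am Fm; case: (F a).
rewrite (pairing_nmodl pP c).2 in pc.
have [pmc pac] : p m c = 0 /\ p a c = 1.
  by move: pc; case: (p m c); case: (p a c).
have cb : c + b = b by apply: sum_upper_bound; rewrite cN pmc /=.
have := (pairing_nmodr pP a).2 c b; rewrite cb pac.
by move: Fa; case: (F a) => // _ ->.
Qed.

Section AdjointActions.

Variable S : finSemigroupType.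

Lemma op_nonzeroP (A : finBModType) (op : S -> A -> A) :
  op_nonzero op <-> exists a s, op s a != 0.
Proof.
split=> [[a [c nz]]|[a [s nz]]]; last first.
  exists a, [ffun t => (t == s) : BB].
  rewrite /BS_op (big_pred1 s) // => t /=.
  by rewrite ffunE; case: (t == s).
apply/'exists_existsP; apply: contraNT nz => /existsPn/(_ a)/existsPn op0.
by rewrite /BS_op big1 // => s _; apply/eqP; have := op0 s; rewrite negbK.
Qed.

Variables (A B : finBModType) (p : A -> B -> BB).
Variables (opA : S -> A -> A) (opB : S -> B -> B).

Definition adjoint : Prop := forall s a b, p (opA s a) b = p a (opB s b).

Lemma adjoint_nonzero : nondegenerate_pairing p -> adjoint ->
  op_nonzero opA -> op_nonzero opB.
Proof.
move=> pP adj /op_nonzeroP[a [s nz]]; apply/op_nonzeroP.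
have [b pb] : exists b, p (opA s a) b != p 0 b.
  apply/existsP; apply: contraNT nz => /existsPn same; apply/eqP.
  by apply: (pairing_sepl pP) => b; apply/eqP; rewrite -[_ == _]negbK same.
exists b, s; apply: contraNneq pb => sb0.
by rewrite adj sb0 (pairing_nmodr pP a).1 (pairing_nmodl pP b).1.
Qed.

(** If [N] separates the points of [A], each [b0] in [B] agrees with an element of
    [N] as a functional on [A].  Otherwise the congruence of [N] is not trivial,
    hence not proper, and [N] takes at every point its value 0 at 0. *)
Lemma simple_minimal : nondegenerate_pairing p -> adjoint ->
  (forall r, op_congruence opA r -> proper_rel r -> trivial_rel r) ->
  forall N, op_submodule opB N -> N = [set 0] \/ N = [set: B].
Proof.
move=> pP adj simple N [Nclosed Nop].
pose r := [rel a a' | [forall (b | b \in N), p a b == p a' b]].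
have rP a a' : reflect {in N, p a =1 p a'} (r a a') by apply: 'forall_in_eqP.
have r_cong : op_congruence opA r.
  split=> [a b c|a a' b b' /rP aa' /rP bb'|s a a' /rP aa'].
  - split=> [|/rP ab]; first exact/rP.
    by apply/rP/rP => H d dN; rewrite ?ab ?H // -ab ?H.
  - by apply/rP => c cN; rewrite !(pairing_nmodl pP c).2 aa' ?bb'.
  - by apply/rP => c cN; rewrite !adj aa' ?Nop.
have [/existsP[a /existsP[a' naa']]|nproper] :=
    boolP [exists a, exists a', ~~ r a a'].
  right; apply/setP => b0; rewrite inE.
  have triv := simple r r_cong (ex_intro _ a (ex_intro _ a' naa')).
  have [b bN b0b] : exists2 b, b \in N & p^~ b0 =1 p^~ b.
    apply: separating_set_represents => // [c c' cc'|].
      exact/triv/rP.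
    exact: pairing_nmodl.
  by rewrite (pairing_sepr pP b0b).
left; apply/setP => b; rewrite inE; apply/idP/eqP => [bN|->];
  last exact: Nclosed.1.
apply: (pairing_sepr pP) => a; rewrite (pairing_nmodr pP a).1.
have /rP/(_ b bN) -> : r a 0.
  by move/existsPn/(_ a)/existsPn/(_ 0): nproper; rewrite negbK.
exact: (pairing_nmodl pP b).1.
Qed.

(** For the submodule [N] of a congruence [r], [N = B] makes related elements equal
    under all of [B].  [N = 0] is excluded: if [r] is proper, a nonzero functional
    is constant on its classes, and [B] represents all functionals on [A]. *)
Lemma minimal_simple : nondegenerate_pairing p -> adjoint ->
  (forall N, op_submodule opB N -> N = [set 0] \/ N = [set: B]) ->
  forall r, op_congruence opA r -> proper_rel r -> trivial_rel r.
Proof.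
move=> pP adj minimal r [r_eqv rD rop] [m [n nmn]].
pose N := [set b | [forall a, forall a', r a a' ==> (p a b == p a' b)]].
have NP b : reflect (forall a a', r a a' -> p a b = p a' b) (b \in N).
  rewrite inE; apply: (iffP forallP) => [H a a' raa'|H a].
    by apply/eqP; move/forallP/(_ a')/implyP: (H a); apply.
  by apply/forallP => a'; apply/implyP => /H ->.
have N_sub : op_submodule opB N.
  split; first split.
  - by apply/NP => a a' _; rewrite !(pairing_nmodr pP _).1.
  - move=> b c /NP bN /NP cN; apply/NP => a a' raa'.
    by rewrite !(pairing_nmodr pP _).2 (bN _ _ raa') (cN _ _ raa').
  - by move=> s b /NP bN; apply/NP => a a' raa'; rewrite -!adj; apply/bN/rop.
case: (minimal N N_sub) => NE; last first.
  move=> a a' raa'; apply: (pairing_sepl pP) => b.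
  by have /NP/(_ a a' raa') : b \in N by rewrite NE inE.
have [F [F_nmod F_compat Fmn]] := congruence_separated r_eqv rD nmn.
have [b _ Fb] : exists2 b, b \in [set: B] & F =1 p^~ b.
  apply: separating_set_represents => // [|a a' aa'].
    by split=> [|b c]; rewrite !inE.
  by apply: (pairing_sepl pP) => b; rewrite aa' ?inE.
have /set1P b0 : b \in [set 0].
  by rewrite -NE; apply/NP => a a' raa'; rewrite -!Fb; apply: F_compat.
by case/eqP: Fmn; rewrite !Fb b0 !(pairing_nmodr pP _).1.
Qed.

End AdjointActions.

Lemma simple_iff_minimal (S : finSemigroupType) (A B : finBModType)
    (p : A -> B -> BB) (opA : S -> A -> A) (opB : S -> B -> B) :
  nondegenerate_pairing p -> adjoint p opA opB ->
  op_simple opA <-> op_minimal opB.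
Proof.
move=> pP adj; split=> -[nz H]; split.
- exact: (adjoint_nonzero pP adj nz).
- exact: (simple_minimal pP adj H).
- apply: (adjoint_nonzero (nondegenerate_flip pP) _ nz).
  by move=> s b a; rewrite adj.
- exact: (minimal_simple pP adj H).
Qed.

(** The points of [M] are separated by its functionals because equality is a
    congruence. *)
Lemma evaluation_nondegenerate (M : finBModType) :
  nondegenerate_pairing (fun (m : M) (f : dual M) => f m).
Proof.
split=> [f|m|m n|f g fg]; last exact/dualP.
- exact: dual_nmod.
- by split=> [|f g]; rewrite ?dual0E ?dualDE.
move=> same; apply/eqP/negPn/negP => neq.
have [||F [F_nmod _]] := @congruence_separated M eq_op m n _ _ neq.
- by move=> x y z; split=> [|/eqP->].
- by move=> x x' y y' /eqP-> /eqP->.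
have F_fun : functional [ffun x => F x].
  by apply/functionalP; case: F_nmod => F0 FD; split=> [|x y]; rewrite !ffunE.
by have := same (Dual F_fun); rewrite /= !ffunE => ->; rewrite eqxx.
Qed.

Theorem theorem4p8 (S : finSemigroupType) (M : finRightBSModType S) :
  (right_simple M <-> left_minimal (dual M : finLeftBSModType S)) /\
  (right_minimal M <-> left_simple (dual M : finLeftBSModType S)).
Proof.
have evP := evaluation_nondegenerate M; split.
  by apply: (simple_iff_minimal evP) => s m f; rewrite -dual_lactE.
apply: iff_sym; apply: (simple_iff_minimal (nondegenerate_flip evP)).
by move=> s f m; rewrite -dual_lactE.
Qed.
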